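(* Let $R_c,\kappa_1,\kappa_2>0$ be constants, $c_1=c_2=0$, $k_{min}>0$ fixed, and $k_{max}=\pi/h$ with $0<h<\pi/k_{min}$. Then the solution $p^\ast$ of the min-max problem $\min_{p>0}\max_{k\in[k_{min},k_{max}]}|\rho_{SR}(k,p)|$ is given in closed form by $$p^\ast=\frac{\pi R_c\kappa_1\kappa_2k_{min}+\sqrt{\pi}\sqrt{\big((\pi R_c\kappa_1+h)\kappa_2+h\kappa_1\big)k_{min}\big((R_c\kappa_1k_{min}+1)\kappa_2+\kappa_1\big)}}{\big(R_c(hk_{min}+\pi)\kappa_2+h\big)\kappa_1+h\kappa_2},$$ which for small $h$ has the asymptotic expansion $$p^\ast=\hat C_p+O(h),\qquad \hat C_p=k_{min}+\sqrt{k_{min}^2+\frac{k_{min}}{R_c\kappa_1}+\frac{k_{min}}{R_c\kappa_2}} .$$ The corresponding convergence factor satisfies $$\max_{k_{min}\le k\le\pi/h}|\rho_{SR}(k,p^\ast)|=\frac{1}{(R_c\kappa_1\hat C_p+1)(R_c\kappa_2\hat C_p+1)}+O(h).$$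
   Context: With $c_1=c_2=0$, for $i=1,2$ and $k>0$ let $\xi_i(k)=\frac{1}{\kappa_ik}$, and $$\rho_{SR}(k,p)=\frac{\xi_1(p)-\xi_1(k)}{\xi_1(p)+R_c+\xi_2(k)}\cdot\frac{\xi_2(p)-\xi_2(k)}{\xi_2(p)+R_c+\xi_1(k)}$$ (convergence factor of the optimized Schwarz method with scaled Robin transmission condition). $O(h)$ is as $h\to0^+$ with all other parameters fixed. *)

(* Defs.v *)
From HB Require Import structures.
From mathcomp Require Import all_boot all_order all_algebra.
From mathcomp Require Import all_classical all_reals all_analysis.
Import Order.TTheory GRing.Theory Num.Theory.
Import numFieldNormedType.Exports.

Set Implicit Arguments.
Unset Strict Implicit.
Unset Printing Implicit Defensive.

Local Open Scope classical_set_scope.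
Local Open Scope ring_scope.

Definition xi {R : realType} (kappa k : R) : R := 1 / (kappa * k).

Definition rhoSR {R : realType} (Rc kappa1 kappa2 k p : R) : R :=
  (xi kappa1 p - xi kappa1 k) / (xi kappa1 p + Rc + xi kappa2 k) *
  ((xi kappa2 p - xi kappa2 k) / (xi kappa2 p + Rc + xi kappa1 k)).

(* Frequencies resolved on a grid of size h: k_max = pi / h. *)
Definition freqs {R : realType} (kmin h : R) : set R := `[kmin, pi / h].

Definition is_max {R : realType} (A : set R) (m : R) : Prop :=
  A m /\ ubound A m.

Definition absrho {R : realType} (Rc kappa1 kappa2 kmin h p : R) : set R :=
  [set `|rhoSR Rc kappa1 kappa2 k p| | k in freqs kmin h].

(* [sup] is total, and is 0 on sets without a supremum; it is the maximum only
   when [is_max] holds of it. *)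
Definition max_rho {R : realType} (Rc kappa1 kappa2 kmin h p : R) : R :=
  sup (absrho Rc kappa1 kappa2 kmin h p).

Definition minmax_solution {R : realType}
    (Rc kappa1 kappa2 kmin h p : R) : Prop :=
  0 < p /\
  forall q : R, 0 < q ->
    max_rho Rc kappa1 kappa2 kmin h p <= max_rho Rc kappa1 kappa2 kmin h q.

Definition pstar {R : realType} (Rc kappa1 kappa2 kmin h : R) : R :=
  (pi * Rc * kappa1 * kappa2 * kmin +
   Num.sqrt pi *
   Num.sqrt (((pi * Rc * kappa1 + h) * kappa2 + h * kappa1) * kmin *
             ((Rc * kappa1 * kmin + 1) * kappa2 + kappa1))) /
  ((Rc * (h * kmin + pi) * kappa2 + h) * kappa1 + h * kappa2).

Definition Cphat {R : realType} (Rc kappa1 kappa2 kmin : R) : R :=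
  kmin +
  Num.sqrt (kmin ^+ 2 + kmin / (Rc * kappa1) + kmin / (Rc * kappa2)).

(* Main.v *)
Require Import Defs.
From HB Require Import structures.
From mathcomp Require Import all_boot all_order all_algebra.
From mathcomp Require Import all_classical all_reals all_analysis.
From mathcomp Require Import ring lra.
Import Order.TTheory GRing.Theory Num.Theory.
Import numFieldNormedType.Exports.

Set Implicit Arguments.
Unset Strict Implicit.
Unset Printing Implicit Defensive.

Local Open Scope classical_set_scope.
Local Open Scope ring_scope.

(** Write a, b for kappa1, kappa2 and c = Rc * a * b.  Clearing denominators,
    rhoSR factors as a * b * u(k) * v(k), where
      u(k) = (k - p) / (b k + a p + c p k)
    and v is u with a and b exchanged.  Both factors are Moebius functions of
    k, strictly increasing for k > 0 and vanishing at k = p; hence rhoSR is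
    nonnegative, strictly decreasing in k up to p and strictly increasing
    after p.  Its maximum for k between kmin and kmax is therefore attained at
    an endpoint, whatever p is ([absrho_max]).

    Exchanging k and p turns u into - v, so rhoSR is symmetric in k and p
    ([rhoSR_sym]), and the same monotonicity holds in p for fixed k.  For p
    between kmin and kmax the value at kmin increases with p while the value
    at kmax decreases, so the minimizer is the unique p at which the two values
    agree: moving p to the right makes the value at kmin larger, moving it to
    the left makes the value at kmax larger ([max_rho_pstar_lt]).

    Equality of the endpoint values reduces to a quadratic equation because the
    denominator D(k) of u * v satisfies
      D(k) = a b (k - p)^2 + p k (a + b + c k) (a + b + c p):
    in (kmin - p)^2 D(kmax) - (kmax - p)^2 D(kmin) the terms
    a b (kmin - p)^2 (kmax - p)^2 cancel, and p (a + b + c p) (kmax - kmin)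
    factors out of the rest
    ([rhoSR_equioscillation]).  The closed form pstar is the positive root of
    the remaining quadratic, and it lies strictly between kmin and kmax
    ([pstar_root]).

    For the asymptotics, pstar is given by an expression in h that is
    differentiable at h = 0, where its value is Cphat.  Multiplying numerators
    and denominators by h likewise extends the factors u and v at k = pi / h,
    which carry the optimal convergence factor, to functions differentiable at
    h = 0.  A function differentiable at 0 differs from its value there by
    O(h) ([eqO_at_right_derivable]). *)

(** * First-order expansions at 0 *)

(** The difference quotient converges, so it is eventually bounded.  The
    function g need only agree with the differentiable f to the right of 0,
    because the optimal convergence factor has an explicit form for small
    positive h only. *)
Lemma eqO_at_right_derivable (R : realType) (f g : R -> R) :
  (\forall h \near 0^'+, g h = f h) -> derivable f 0 1 ->
  g = (fun=> f 0) +O_ (0^'+) (fun h : R => h).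
Proof.
move=> fg df; apply/eqaddOP; set l := 'D_1 f 0.
near=> K; have lK : `|l| + 1 <= K by near: K; exact: nbhs_pinfty_ge.
have : \forall h \near 0^', `|l - h^-1 *: (f (h *: 1 + 0) - f 0)| <= 1.
  by have /cvgr_dist_le := df; apply.
rewrite /dnbhs /= near_withinE => dq.
move: fg; rewrite /at_right /= near_withinE => fg.
rewrite near_withinE; near=> h => h0.
have hn0 : h != 0 by rewrite gt_eqF.
have gf : g h = f h by move: h0; near: h.
have dh : `|l - h^-1 * (f h - f 0)| <= 1.
  have : `|l - h^-1 *: (f (h *: 1 + 0) - f 0)| <= 1 by move: hn0; near: h.
  by rewrite addr0 [h *: 1]mulr1.
suff : `|f h - f 0| <= K * `|h| by rewrite -gf.
have -> : f h - f 0 = h^-1 * (f h - f 0) * h by rewrite mulrAC mulVf ?mul1r.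
rewrite normrM ler_wpM2r //; apply: le_trans lK.
rewrite -[X in `|X|](subrK l) addrC (le_trans (ler_normD _ _)) // lerD2l.
by rewrite distrC.
Unshelve. all: by end_near. Qed.

(** * The convergence factor as a product of two Moebius functions *)

Definition mobius {R : realType} (a b c p k : R) : R :=
  (k - p) / (b * k + a * p + c * p * k).

Lemma rhoSR_mobius (R : realType) (Rc a b k p : R) :
  0 < Rc -> 0 < a -> 0 < b -> 0 < k -> 0 < p ->
  rhoSR Rc a b k p =
  a * b * (mobius a b (Rc * a * b) p k * mobius b a (Rc * a * b) p k).
Proof.
move=> Rc0 a0 b0 k0 p0; rewrite /rhoSR /xi /mobius.
have ? : Rc * a * b * p * k > 0 by rewrite !mulr_gt0.
have ? : b * k > 0 by rewrite mulr_gt0.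
have ? : a * k > 0 by rewrite mulr_gt0.
have ? : b * p > 0 by rewrite mulr_gt0.
have ? : a * p > 0 by rewrite mulr_gt0.
field; do ?[apply/andP; split]; apply/lt0r_neq0; nra.
Qed.

Lemma mobius_lt (R : realType) (a b c p k k' : R) :
  0 < a -> 0 < b -> 0 < c -> 0 < p -> 0 < k -> k < k' ->
  mobius a b c p k < mobius a b c p k'.
Proof.
move=> a0 b0 c0 p0 k0 kk'; rewrite /mobius.
have k'0 : 0 < k' := lt_trans k0 kk'.
rewrite ltr_pdivrMr; last by rewrite !(addr_gt0, mulr_gt0).
rewrite mulrAC ltr_pdivlMr; last by rewrite !(addr_gt0, mulr_gt0).
rewrite -subr_gt0.
have -> : (k' - p) * (b * k + a * p + c * p * k) -
          (k - p) * (b * k' + a * p + c * p * k') =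
          (k' - k) * (p * (a + b + c * p)) by ring.
by rewrite mulr_gt0 ?subr_gt0 // !(addr_gt0, mulr_gt0).
Qed.

Lemma mobius_ge0 (R : realType) (a b c p k : R) :
  0 < a -> 0 < b -> 0 < c -> 0 < p -> 0 < k ->
  (0 <= mobius a b c p k) = (p <= k).
Proof.
by move=> *; rewrite pmulr_lge0 ?subr_ge0 // invr_gt0 !(addr_gt0, mulr_gt0).
Qed.

Lemma mobius_le0 (R : realType) (a b c p k : R) :
  0 < a -> 0 < b -> 0 < c -> 0 < p -> 0 < k ->
  (mobius a b c p k <= 0) = (k <= p).
Proof.
by move=> *; rewrite pmulr_lle0 ?subr_le0 // invr_gt0 !(addr_gt0, mulr_gt0).
Qed.

(** Exchanging k and p turns each factor into the opposite of the other one. *)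
Lemma rhoSR_sym (R : realType) (Rc a b k p : R) :
  0 < Rc -> 0 < a -> 0 < b -> 0 < k -> 0 < p ->
  rhoSR Rc a b k p = rhoSR Rc a b p k.
Proof.
move=> Rc0 a0 b0 k0 p0; rewrite !rhoSR_mobius // [in RHS]mulrC [in LHS]mulrC.
congr (_ * _); rewrite /mobius.
by rewrite !mulf_div; congr (_ / _); ring.
Qed.

Lemma rhoSR_ge0 (R : realType) (Rc a b k p : R) :
  0 < Rc -> 0 < a -> 0 < b -> 0 < k -> 0 < p -> 0 <= rhoSR Rc a b k p.
Proof.
move=> Rc0 a0 b0 k0 p0; rewrite rhoSR_mobius //.
have c0 : 0 < Rc * a * b by rewrite !mulr_gt0.
apply: mulr_ge0; first by rewrite mulr_ge0 // ltW.
have [pk|/ltW kp] := leP p k; first by rewrite mulr_ge0 // mobius_ge0.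
by rewrite mulr_le0 // mobius_le0.
Qed.

(** Beyond p both factors are nonnegative and increasing. *)
Lemma rhoSR_ltr (R : realType) (Rc a b p k k' : R) :
  0 < Rc -> 0 < a -> 0 < b -> 0 < p -> p <= k -> k < k' ->
  rhoSR Rc a b k p < rhoSR Rc a b k' p.
Proof.
move=> Rc0 a0 b0 p0 pk kk'.
have k0 : 0 < k := lt_le_trans p0 pk.
have k'0 : 0 < k' := lt_trans k0 kk'.
have c0 : 0 < Rc * a * b by rewrite !mulr_gt0.
by rewrite !rhoSR_mobius // ltr_pM2l ?mulr_gt0// ltr_pM ?mobius_ge0 ?mobius_lt.
Qed.

(** Up to p both factors are nonpositive and increasing, so their product
    decreases. *)
Lemma rhoSR_ltl (R : realType) (Rc a b p k k' : R) :
  0 < Rc -> 0 < a -> 0 < b -> 0 < k -> k < k' -> k' <= p ->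
  rhoSR Rc a b k' p < rhoSR Rc a b k p.
Proof.
move=> Rc0 a0 b0 k0 kk' k'p.
have k'0 : 0 < k' := lt_trans k0 kk'.
have p0 : 0 < p := lt_le_trans k'0 k'p.
have c0 : 0 < Rc * a * b by rewrite !mulr_gt0.
rewrite !rhoSR_mobius // ltr_pM2l ?mulr_gt0//.
rewrite -[ltLHS]mulrNN -[ltRHS]mulrNN.
by rewrite ltr_pM ?oppr_ge0 ?mobius_le0 // ltrN2 mobius_lt.
Qed.

(** * Equioscillation *)

(** The cross-multiplied difference of the two values is the quadratic times
    p (a + b + c p) (M - m), by the identity for the denominator
    (b k + a p + c p k) (a k + b p + c p k)
      = a b (k - p)^2 + p k (a + b + c k) (a + b + c p). *)
Lemma rhoSR_equioscillation (R : realType) (Rc a b m M p : R) (c := Rc * a * b) :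
  0 < Rc -> 0 < a -> 0 < b -> 0 < m -> 0 < M -> 0 < p ->
  (a + b + c * (m + M)) * p ^+ 2 - 2 * (c * m * M) * p - (a + b) * m * M = 0 ->
  rhoSR Rc a b m p = rhoSR Rc a b M p.
Proof.
move=> Rc0 a0 b0 m0 M0 p0 Q0; rewrite !rhoSR_mobius // -/c.
have c0 : 0 < c by rewrite !mulr_gt0.
congr (_ * _); rewrite /mobius !mulf_div.
have pos (u v k : R) : 0 < u -> 0 < v -> 0 < k -> v * k + u * p + c * p * k != 0.
  by move=> *; apply: lt0r_neq0; rewrite !(addr_gt0, mulr_gt0).
apply/eqP; rewrite eqr_div ?mulf_neq0 ?pos // -subr_eq0; apply/eqP.
transitivity (p * (a + b + c * p) * (M - m) *
  ((a + b + c * (m + M)) * p ^+ 2 - 2 * (c * m * M) * p - (a + b) * m * M)).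
  by ring.
by rewrite Q0 mulr0.
Qed.

(** Multiplying numerator and denominator by h relates the closed form, which
    makes sense at h = 0, to the quadratic formula in terms of M = pi / h. *)
Lemma pstar_grid (R : realType) (Rc a b m h : R) (M := pi / h) (c := Rc * a * b) :
  0 < Rc -> 0 < a -> 0 < b -> 0 < m -> 0 < h ->
  pstar Rc a b m h = (c * m * M +
    Num.sqrt (m * M * (a + b + c * m) * (a + b + c * M))) / (a + b + c * (m + M)).
Proof.
move=> Rc0 a0 b0 m0 h0.
have pi0 : 0 < pi :> R := pi_gt0 R.
have M0 : 0 < M by rewrite divr_gt0.
have piE : pi = h * M by rewrite /M mulrC divfK // gt_eqF.
have c0 : 0 < c by rewrite !mulr_gt0.
rewrite /pstar -sqrtrM ?(ltW pi0)//.
set X := (X in Num.sqrt X); set Y := m * M * _ * _.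
have -> : X = h ^+ 2 * Y by rewrite /X /Y /c piE; ring.
rewrite sqrtrM ?sqr_ge0 // sqrtr_sqr gtr0_norm // piE /c.
have -> : h * M * Rc * a * b * m + h * Num.sqrt Y =
          h * (Rc * a * b * m * M + Num.sqrt Y) by ring.
have -> : (Rc * (h * m + h * M) * b + h) * a + h * b =
          h * (a + b + Rc * a * b * (m + M)) by ring.
by rewrite -mulf_div divff ?gt_eqF // mul1r.
Qed.

(** The quadratic is negative at m and positive at M, which locates its larger
    root strictly between them. *)
Lemma pstar_root (R : realType) (Rc a b m h : R) (M := pi / h) (c := Rc * a * b)
    (p := pstar Rc a b m h) :
  0 < Rc -> 0 < a -> 0 < b -> 0 < m -> 0 < h -> m < M ->
  [/\ m < p, p < M &
  (a + b + c * (m + M)) * p ^+ 2 - 2 * (c * m * M) * p - (a + b) * m * M = 0].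
Proof.
move=> Rc0 a0 b0 m0 h0 mM; rewrite /p pstar_grid // -/M -/c.
have M0 : 0 < M := lt_trans m0 mM.
have c0 : 0 < c by rewrite !mulr_gt0.
clearbody c M; set D := m * M * _ * _; set L := a + b + _.
have L0 : 0 < L by rewrite !(addr_gt0, mulr_gt0).
have D0 : 0 < D by rewrite !(addr_gt0, mulr_gt0).
have DE : (Num.sqrt D) ^+ 2 = D by rewrite sqr_sqrtr ?ltW.
have S0 : 0 < Num.sqrt D by rewrite sqrtr_gt0.
(* L times the quadratic at x is (L x - c m M)^2 - D, so comparing x with the
   root amounts to comparing squares. *)
split.
- rewrite ltr_pdivlMr // -ltrBlDl; apply: contraTT isT; rewrite -leNgt => le.
  have : (Num.sqrt D) ^+ 2 <= (m * L - c * m * M) ^+ 2.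
    by rewrite lerXn2r ?nnegrE ?(ltW S0) ?(le_trans (ltW S0) le).
  rewrite DE -subr_ge0.
  have -> : (m * L - c * m * M) ^+ 2 - D = - (L * m * (M - m) * (a + b + c * m)).
    by rewrite /D /L; ring.
  by rewrite oppr_ge0 leNgt !mulr_gt0 ?subr_gt0 // !(addr_gt0, mulr_gt0).
- rewrite ltr_pdivrMr // -ltrBrDl.
  have LM : 0 < M * L - c * m * M.
    have -> : M * L - c * m * M = M * (a + b + c * M) by rewrite /L; ring.
    by rewrite !(addr_gt0, mulr_gt0).
  rewrite -(ltr_pXn2r (n:=2)) ?nnegrE ?ltW // DE -subr_gt0.
  have -> : (M * L - c * m * M) ^+ 2 - D = L * M * (M - m) * (a + b + c * M).
    by rewrite /D /L; ring.
  by rewrite !mulr_gt0 ?subr_gt0 // !(addr_gt0, mulr_gt0).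
- set S := Num.sqrt D in DE S0 *.
  transitivity ((S ^+ 2 - D) / L); last by rewrite DE subrr mul0r.
  by rewrite /D /L; field; rewrite gt_eqF.
Qed.

(** * The min-max problem *)

Lemma is_max_sup (R : realType) (A : set R) (x : R) : is_max A x -> sup A = x.
Proof.
move=> [Ax ubx]; apply/eqP; rewrite eq_le ge_sup //; last by exists x.
by apply: ub_le_sup => //; exists x.
Qed.

Section Minmax.
Variables (R : realType) (Rc a b m h : R).
Hypotheses (Rc0 : 0 < Rc) (a0 : 0 < a) (b0 : 0 < b) (m0 : 0 < m).
Hypotheses (h0 : 0 < h) (mM : m < pi / h).

Lemma absrho_max (p : R) : 0 < p ->
  is_max (absrho Rc a b m h p)
         (Num.max (rhoSR Rc a b m p) (rhoSR Rc a b (pi / h) p)).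
Proof.
move=> p0; have M0 : 0 < pi / h := lt_trans m0 mM.
have mem k : m <= k <= pi / h -> absrho Rc a b m h p (rhoSR Rc a b k p).
  move=> kin; exists k; first by rewrite /freqs /= in_itv.
  rewrite ger0_norm // rhoSR_ge0 //.
  by case/andP: kin => mk _; exact: lt_le_trans mk.
split; first by case: leP => _; apply: mem; rewrite lexx ?ltW.
move=> _ [k /= + <-]; rewrite /freqs /= in_itv /= => /andP[mk kM].
have k0 : 0 < k := lt_le_trans m0 mk.
rewrite ger0_norm ?rhoSR_ge0 // le_max.
have [kp|/ltW pk] := leP k p; apply/orP; [left|right].
- move: mk; rewrite le_eqVlt => /predU1P[->//|mk].
  by rewrite ltW // rhoSR_ltl.
- move: kM; rewrite le_eqVlt => /predU1P[->//|kM].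
  by rewrite ltW // rhoSR_ltr.
Qed.

Lemma max_rhoE (p : R) : 0 < p ->
  max_rho Rc a b m h p = Num.max (rhoSR Rc a b m p) (rhoSR Rc a b (pi / h) p).
Proof. by move=> p0; apply/is_max_sup/absrho_max. Qed.

Lemma max_rho_pstar :
  max_rho Rc a b m h (pstar Rc a b m h) =
  rhoSR Rc a b (pi / h) (pstar Rc a b m h).
Proof.
have [mp pM pQ] := pstar_root Rc0 a0 b0 m0 h0 mM.
have p0 := lt_trans m0 mp.
rewrite max_rhoE // (@rhoSR_equioscillation _ _ _ _ m (pi / h)) ?maxxx //.
exact: lt_trans mM.
Qed.

(** To the right of pstar the value at kmin exceeds the common value of the two
    ends, and to the left the value at kmax does. *)
Lemma max_rho_pstar_lt (q : R) : 0 < q -> q != pstar Rc a b m h ->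
  max_rho Rc a b m h (pstar Rc a b m h) < max_rho Rc a b m h q.
Proof.
move=> q0 qp; have [mp pM pQ] := pstar_root Rc0 a0 b0 m0 h0 mM.
have p0 := lt_trans m0 mp; have M0 := lt_trans m0 mM.
rewrite max_rho_pstar max_rhoE // lt_max.
have [pq|qp'] := ltP (pstar Rc a b m h) q; apply/orP; [left|right].
- rewrite -(@rhoSR_equioscillation _ _ _ _ m) //.
  by rewrite [ltLHS]rhoSR_sym // [ltRHS]rhoSR_sym // rhoSR_ltr // ltW.
- have qltp : q < pstar Rc a b m h by rewrite lt_neqAle qp.
  by rewrite [ltLHS]rhoSR_sym // [ltRHS]rhoSR_sym // rhoSR_ltl // ltW.
Qed.

Lemma minmax_solutionP (p : R) :
  minmax_solution Rc a b m h p <-> p = pstar Rc a b m h.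
Proof.
have [mp _ _] := pstar_root Rc0 a0 b0 m0 h0 mM; have p0 := lt_trans m0 mp.
split=> [[pgt0 pmin]|->].
  have [//|neq] := eqVneq p (pstar Rc a b m h).
  by have := pmin _ p0; rewrite leNgt max_rho_pstar_lt.
split=> // q q0; have [->//|neq] := eqVneq q (pstar Rc a b m h).
by rewrite ltW // max_rho_pstar_lt.
Qed.
End Minmax.

(** * Small grid size *)

Lemma pstar0 (R : realType) (Rc a b m : R) :
  0 < Rc -> 0 < a -> 0 < b -> 0 < m -> pstar Rc a b m 0 = Cphat Rc a b m.
Proof.
move=> Rc0 a0 b0 m0; rewrite /pstar /Cphat.
move: (pi : R) (pi_gt0 R) => q q0.
have c0 : 0 < Rc * a * b by rewrite !mulr_gt0.
rewrite -sqrtrM ?(ltW q0)//.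
set Y := m ^+ 2 + _ + _.
set X := (X in Num.sqrt X).
have -> : X = (q * (Rc * a * b)) ^+ 2 * Y.
  by rewrite /X /Y; field; rewrite !gt_eqF.
rewrite sqrtrM ?sqr_ge0 // sqrtr_sqr gtr0_norm ?mulr_gt0 //.
by rewrite !(mul0r, add0r, addr0); field; rewrite !gt_eqF.
Qed.

(** At h = 0 the argument of the square root and the denominator are positive,
    so both operations are differentiable there. *)
Lemma derivable_pstar (R : realType) (Rc a b m : R) :
  0 < Rc -> 0 < a -> 0 < b -> 0 < m -> derivable (pstar Rc a b m) 0 1.
Proof.
move=> Rc0 a0 b0 m0; have pi0 : 0 < pi :> R := pi_gt0 R.
have sqrtD (f : R -> R) : derivable f 0 1 -> 0 < f 0 ->
    derivable (Num.sqrt \o f) 0 1.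
  move=> /derivableP df f0; apply: ex_derive.
  by apply: is_derive1_comp; exact: is_derive1_sqrt.
rewrite /pstar; apply: derivableM.
  apply: derivableD; first exact: ex_derive.
  apply: derivableM; first exact: ex_derive.
  apply: (@sqrtD (fun h : R => _)); first exact: ex_derive.
  rewrite /= !mul0r !addr0 mulr_gt0 //; first by rewrite !mulr_gt0.
  by rewrite addr_gt0 // mulr_gt0 // addr_gt0 // !mulr_gt0.
apply: derivableV; last exact: ex_derive.
by rewrite /= !mul0r add0r !addr0 gt_eqF // !mulr_gt0.
Qed.

(** [mobius a b c p (pi / h)] with numerator and denominator multiplied by h:
    this extends the factor at the highest frequency to h = 0. *)
Definition mobius_top {R : realType} (a b c p h : R) : R :=
  (pi - h * p) / (b * pi + a * (h * p) + c * (pi * p)).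

Lemma mobius_topE (R : realType) (a b c p h : R) :
  0 < h -> mobius a b c p (pi / h) = mobius_top a b c p h.
Proof.
move=> h0; have hn0 : h != 0 by rewrite gt_eqF.
rewrite /mobius /mobius_top.
have -> : pi - h * p = h * (pi / h - p) by field.
have -> : b * pi + a * (h * p) + c * (pi * p) =
          h * (b * (pi / h) + a * p + c * p * (pi / h)) by field.
by rewrite -mulf_div divff ?mul1r.
Qed.

Lemma mobius_top0 (R : realType) (a b c p : R) :
  mobius_top a b c p 0 = 1 / (b + c * p).
Proof.
rewrite /mobius_top mul0r mulr0 subr0 addr0.
have -> : b * pi + c * (pi * p) = pi * (b + c * p) by ring.
by rewrite invfM mulrA divff // gt_eqF // pi_gt0.
Qed.

Lemma derivable_mobius_top (R : realType) (a b c : R) (p : R -> R) :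
  0 < b -> 0 < c -> 0 < p 0 -> derivable p 0 1 ->
  derivable (fun h : R => mobius_top a b c (p h) h) 0 1.
Proof.
move=> b0 c0 p0 dp; have dcst (k : R) : derivable (fun _ : R => k) 0 1.
  exact: derivable_cst.
have dhp : derivable (fun h : R => h * p h) 0 1.
  by apply: derivableM => //; exact: ex_derive.
rewrite /mobius_top; apply: derivableM.
  exact: (derivableB (dcst pi) dhp).
apply: derivableV.
  rewrite mul0r mulr0 addr0.
  have -> : b * pi + c * (pi * p 0) = pi * (b + c * p 0) by ring.
  by rewrite gt_eqF // mulr_gt0 ?pi_gt0 // addr_gt0 // mulr_gt0.
apply: (derivableD (derivableD (dcst (b * pi)) (derivableM (dcst a) dhp))).
exact: (derivableM (dcst c) (derivableM (dcst pi) dp)).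
Qed.

Theorem theorem3p7 (R : realType) (Rc kappa1 kappa2 kmin : R)
    (Rc_gt0 : 0 < Rc) (kappa1_gt0 : 0 < kappa1) (kappa2_gt0 : 0 < kappa2)
    (kmin_gt0 : 0 < kmin) :
  [/\ forall h : R, 0 < h < pi / kmin ->
        (forall p : R, 0 < p ->
           is_max (absrho Rc kappa1 kappa2 kmin h p)
                  (max_rho Rc kappa1 kappa2 kmin h p)) /\
        (forall p : R, minmax_solution Rc kappa1 kappa2 kmin h p <->
                       p = pstar Rc kappa1 kappa2 kmin h),
      (fun h : R => pstar Rc kappa1 kappa2 kmin h) =
        (fun=> Cphat Rc kappa1 kappa2 kmin) +O_ (0^'+) (fun h : R => h)
    & (fun h : R =>
         max_rho Rc kappa1 kappa2 kmin h (pstar Rc kappa1 kappa2 kmin h)) =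
        (fun=> 1 / ((Rc * kappa1 * Cphat Rc kappa1 kappa2 kmin + 1) *
                    (Rc * kappa2 * Cphat Rc kappa1 kappa2 kmin + 1)))
        +O_ (0^'+) (fun h : R => h)].
Proof.
have ltM h : 0 < h -> h < pi / kmin -> kmin < pi / h.
  by move=> h0; rewrite !ltr_pdivlMr // mulrC.
split.
- move=> h /andP[h0 /(ltM _ h0) hM]; split=> p; last exact: minmax_solutionP.
  by move=> p0; rewrite max_rhoE //; exact: absrho_max.
- rewrite -pstar0 //; apply: eqO_at_right_derivable; last exact: derivable_pstar.
  by near=> h.
- set C := Cphat Rc kappa1 kappa2 kmin; pose c := Rc * kappa1 * kappa2.
  have c0 : 0 < c by rewrite !mulr_gt0.
  have C0 : 0 < C by rewrite ltr_wpDr // sqrtr_ge0.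
  have pC : pstar Rc kappa1 kappa2 kmin 0 = C by exact: pstar0.
  have dp : derivable (pstar Rc kappa1 kappa2 kmin) 0 1.
    exact: derivable_pstar.
  (* By equioscillation the optimal value can be read at either end; the end
     pi / h is the one whose factors have an explicit value at h = 0. *)
  have max_rho_top h : 0 < h -> h < pi / kmin ->
      max_rho Rc kappa1 kappa2 kmin h (pstar Rc kappa1 kappa2 kmin h) =
      kappa1 * kappa2 *
      (mobius_top kappa1 kappa2 c (pstar Rc kappa1 kappa2 kmin h) h *
       mobius_top kappa2 kappa1 c (pstar Rc kappa1 kappa2 kmin h) h).
    move=> h0 /(ltM _ h0) hM.
    have [mp _ _] := pstar_root Rc_gt0 kappa1_gt0 kappa2_gt0 kmin_gt0 h0 hM.
    have M0 := lt_trans kmin_gt0 hM; have p0 := lt_trans kmin_gt0 mp.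
    by rewrite max_rho_pstar // rhoSR_mobius // !mobius_topE.
  move: (pstar Rc kappa1 kappa2 kmin) => p in pC dp max_rho_top *.
  have -> : 1 / ((Rc * kappa1 * C + 1) * (Rc * kappa2 * C + 1)) =
            kappa1 * kappa2 * (mobius_top kappa1 kappa2 c (p 0) 0 *
                               mobius_top kappa2 kappa1 c (p 0) 0).
    rewrite pC !mobius_top0 /c; move: (C) C0 => x x0; field.
    by rewrite !gt_eqF // !(addr_gt0, mulr_gt0).
  apply: (@eqO_at_right_derivable _ (fun h : R => kappa1 * kappa2 *
    (mobius_top kappa1 kappa2 c (p h) h * mobius_top kappa2 kappa1 c (p h) h))).
    near=> h; apply: max_rho_top; first by [].
    by near: h; apply: nbhs_right_lt; rewrite divr_gt0 ?pi_gt0.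
  apply: derivableM; first exact: derivable_cst.
  by apply: derivableM; apply: derivable_mobius_top; rewrite ?pC.
Unshelve. all: by end_near. Qed.
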